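(* Let $(C,\Omega)$ be a shellable chain complex over a principal ring $R$, finite of order $d$, and let $\Gamma\subset\Omega$ be the subset of all maximal basis elements. Then a monotonically descending shelling of $\Gamma=\{g_1,\ldots,g_k\}$ exists.
   Context: A principal ring $R$ is an integral domain (commutative with $1$) all of whose ideals are principal. **Chain complexes.** A chain complex $(C,\Omega)$ over $R$ consists of free $R$-modules $C_\nu$ ($\nu\geq 0$), each with a fixed finite (possibly empty) basis $\Omega_\nu$, and $R$-linear maps $\partial_\nu\colon C_\nu\to C_{\nu-1}$ ($\nu\geq1$), $\partial_0\colon C_0\to 0$, with $\partial_\nu\circ\partial_{\nu+1}=0$; $\Omega=\bigcup_\nu\Omega_\nu$. It is finite of order $d$ if $C_\nu=0$ for $\nu>d$ and $C_d\neq0$. For $x=\sum_i a_ie^\nu_i\in C_\nu$ (with $e^\nu_i\in\Omega_\nu$), $\operatorname{supp}(x)=\{e^\nu_i\mid a_i\neq0\}$ and $\operatorname{bd}(x)=\operatorname{supp}(\partial_\nu x)$. The $i$-skeleton $\operatorname{sk}_i(C)$ is the subcomplex with chain modules $C_\nu$ (basis $\Omega_\nu$) for $0\leq\nu\leq i$ and $0$ for $\nu>i$. A finite complex of order $d$ is pure if every $e\in\Omega_\nu$, $0\leq\nu\leq d-1$, lies in $\operatorname{bd}(f)$ for some $f\in\Omega_{\nu+1}$. A basis element is maximal if it lies in $\operatorname{bd}(f)$ for no $f\in\Omega$; $\Gamma$ is the set of all maximal basis elements. For $e\in\Omega_\mu$ the subcomplex $(C_e,\Omega_e)$ has bases $(\Omega_e)_\nu=\emptyset$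 for $\nu>\mu$, $(\Omega_e)_\mu=\{e\}$, and $(\Omega_e)_\nu=\bigcup_{f\in(\Omega_e)_{\nu+1}}\operatorname{bd}(f)$ for $0\leq\nu\leq\mu-1$. Put $s(e)=\mu$. A subset $T\subset\Omega$ such that $\Omega_e\subset T$ for all $e\in T$ generates the subcomplex with basis $T$; $T_\nu=T\cap\Omega_\nu$. **Shellings** (recursive in $d$). Let $(C,\Omega)$ be finite of order $d$ with $\Gamma\neq\emptyset$. An order $g_1,\ldots,g_k$ of the elements of $\Gamma$ is a shelling if $d=0$, or if $d\geq1$ and: (S1) for $2\leq j\leq k$ the set $\Omega_{g_j}\cap\bigcup_{i=1}^{j-1}\Omega_{g_i}$ generates a pure chain complex of order $s(g_j)-1$; (S2) for $2\leq j\leq k$ the set $(\Omega_{g_j})_{s(g_j)-1}$ has a shelling in which the elements of $\bigl(\Omega_{g_j}\cap\bigcup_{i=1}^{j-1}\Omega_{g_i}\bigr)_{s(g_j)-1}$ come first; (S3) $(\Omega_{g_1})_{s(g_1)-1}$ has a shelling. Here (S1), (S2) are regarded as satisfied when $s(g_j)=0$, and for $s(g)\geq1$ a shelling of $(\Omega_g)_{s(g)-1}=\operatorname{bd}(g)$ means a shelling of $\operatorname{sk}_{s(g)-1}(C_g)$, whose maximal elements are exactly the elements of $\operatorname{bd}(g)$. $(C,\Omega)$ is shellable if a shelling exists. A shelling $g_1,\ldots,g_k$ is monotonically descending if $s(g_i)\geq s(g_{i+1})$ for all $1\leq i\leq k-1$. *)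

(* Defs.v *)
From HB Require Import structures.
From mathcomp Require Import all_boot all_order all_algebra.

Set Implicit Arguments.
Unset Strict Implicit.
Unset Printing Implicit Defensive.

Import GRing.Theory.
Local Open Scope ring_scope.

(* Ideals are Prop-valued, so that undecidable ones are included; the          *)
(* library's [idealr_closed] covers proper boolean ideals only.                *)
Definition is_ideal (R : idomainType) (I : R -> Prop) : Prop :=
  [/\ I 0, forall x y, I x -> I y -> I (x + y) & forall a x, I x -> I (a * x)].

Definition principal_ring (R : idomainType) : Prop :=
  forall I : R -> Prop, is_ideal I ->
  exists a, forall x, I x <-> exists r, x = r * a.

(* C_n is the free module {ffun basis n -> R^o} on the finite set Omega_n;     *)
(* bdry n is the map C_(n+1) -> C_n.  The map C_0 -> 0 carries no data.        *)
Record chainComplex (R : idomainType) := ChainComplex {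
  basis : nat -> finType;
  bdry : forall n,
    {linear {ffun basis n.+1 -> R^o} -> {ffun basis n -> R^o}};
  bdry_bdry : forall n x, bdry n (bdry n.+1 x) = 0
}.

Section Cells.

Context {R : idomainType} {C : chainComplex R}.

Definition chain (n : nat) := {ffun basis C n -> R^o}.

(* The disjoint union Omega of the bases. *)
Definition cell : choiceType := {n : nat & basis C n}.

Definition deg (e : cell) : nat := tag e.

Definition basis_chain n (e : basis C n) : chain n := [ffun f => (f == e)%:R].

Definition supp n (x : chain n) : seq cell :=
  [seq Tagged (basis C) e | e in [pred e | x e != 0]].

Definition bd (e : cell) : seq cell :=
  let: existT n b := e in
  match n return basis C n -> seq cell with
  | 0 => fun=> [::]
  | m.+1 => fun b => supp (bdry C m (basis_chain b))
  end b.

(* face_level e k is (Omega_e)_(s(e) - k). *)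
Fixpoint face_level (e : cell) (k : nat) : seq cell :=
  if k is k'.+1 then flatten [seq bd f | f <- face_level e k'] else [:: e].

Definition face_set (e : cell) : {pred cell} :=
  [pred f | (deg f <= deg e)%N && (f \in face_level e (deg e - deg f))].

(* A subcomplex is represented by its set T of basis elements; its n-th chain  *)
(* module consists of the n-chains of C supported in T.  Supports, boundaries  *)
(* and the sets Omega_e computed in the subcomplex are those computed in C.    *)
Definition generates_subcomplex (T : {pred cell}) : Prop :=
  forall e, e \in T -> {subset face_set e <= T}.

Definition in_chain_module (T : {pred cell}) n (x : chain n) : Prop :=
  {subset supp x <= T}.

Definition finite_of_order (T : {pred cell}) (d : nat) : Prop :=
  [/\ generates_subcomplex T,
      forall n (x : chain n), (d < n)%N -> in_chain_module T x -> x = 0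
    & exists2 x : chain d, in_chain_module T x & x <> 0].

Definition in_degree (T : {pred cell}) (n : nat) : {pred cell} :=
  [pred e | (e \in T) && (deg e == n)].

Definition skeleton (i : nat) (T : {pred cell}) : {pred cell} :=
  [pred e | (e \in T) && (deg e <= i)%N].

Definition pure_of_order (T : {pred cell}) (d : nat) : Prop :=
  finite_of_order T d /\
  forall n e, (n < d)%N -> e \in in_degree T n ->
    exists2 f, f \in in_degree T n.+1 & e \in bd f.

Definition maximal_cell (T : {pred cell}) (e : cell) : Prop :=
  e \in T /\ forall f, f \in T -> e \notin bd f.

Definition is_order_of (P : cell -> Prop) (gs : seq cell) : Prop :=
  uniq gs /\ forall e, e \in gs <-> P e.

Definition face_sets (gs : seq cell) : {pred cell} :=
  [pred e | has (fun g => e \in face_set g) gs].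

Definition meet_previous (pre : seq cell) (g : cell) : {pred cell} :=
  [predI face_set g & face_sets pre].

Definition come_first (A : {pred cell}) (hs : seq cell) : Prop :=
  exists hs1 hs2, [/\ hs = hs1 ++ hs2, {in hs1, forall h, h \in A}
                    & {in hs2, forall h, h \notin A}].

Definition lower_skeleton (g : cell) : {pred cell} :=
  skeleton (deg g).-1 (face_set g).

(* The recursion runs through lower_skeleton g, of order deg g - 1 < d, so the *)
(* least fixed point is the recursive definition.  The splitting               *)
(* gs = pre ++ g :: post with pre nonempty means g = g_j with j >= 2 and       *)
(* pre = g_1, .., g_(j-1).  All three conditions are void for cells of degree *)
(* 0; for g_1 and d >= 1 this never occurs, by the first condition at the      *)
(* first g_j of positive degree.                                               *)
Inductive shelling (T : {pred cell}) (gs : seq cell) : Prop :=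
  Shelling (d : nat) of
      finite_of_order T d
    & (exists g, maximal_cell T g)
    & is_order_of (maximal_cell T) gs
    & ((0 < d)%N -> forall pre g post, gs = pre ++ g :: post ->
         pre <> [::] -> (0 < deg g)%N ->
         pure_of_order (meet_previous pre g) (deg g).-1)
    & ((0 < d)%N -> forall pre g post, gs = pre ++ g :: post ->
         pre <> [::] -> (0 < deg g)%N ->
         exists2 hs, shelling (lower_skeleton g) hs &
           come_first (in_degree (meet_previous pre g) (deg g).-1) hs)
    & ((0 < d)%N -> forall g post, gs = g :: post -> (0 < deg g)%N ->
         exists hs, shelling (lower_skeleton g) hs).

Definition shellable (T : {pred cell}) : Prop := exists gs, shelling T gs.

Definition monotonically_descending (gs : seq cell) : Prop :=
  sorted geq [seq deg g | g <- gs].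

End Cells.

Arguments cell {R} C.

Definition Omega (R : idomainType) (C : chainComplex R) : {pred cell C} := predT.
Arguments Omega {R} C.

(* Main.v *)
Require Import Defs.
From mathcomp Require Import all_boot all_order all_algebra.

(** The theorem is the rearrangement argument for nonpure shellings: a shelling
    can be bubble-sorted.  Whenever two consecutive cells [a], [b] of a shelling
    satisfy [deg a < deg b], exchanging them gives again a shelling
    ([attached_along_swap]); repeating this sorts the degrees
    ([sort_by_adjacent_swaps]).

    The exchange is harmless because such an [a] meets [b] only inside the union
    [U] of the cells that precede both ([low_maximal_cell_adds_nothing]).
    Indeed, the intersection of [b] with [U] and [a] is pure of order
    [deg b - 1], so each of its cells is a face of some [f] of degree
    [deg b - 1 >= deg a] in the intersection.  If [f] were a face of [a], then
    [f = a] by degree, and the maximal cell [a] would be a proper face of [b].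
    So [f], and every face of [f], lies in [U].  Consequently [b] meets [U] in
    what it met together with [a], and [a] meets [U] together with [b] in what it
    met before: both conditions of attachment are literally unchanged.  The
    argument also shows that [U] is not empty, as the intersection contains a
    cell; hence the first cell of the shelling never moves. *)

Set Implicit Arguments.
Unset Strict Implicit.
Unset Printing Implicit Defensive.

Import GRing.Theory.

(** * Sorting by adjacent exchanges *)

Section SortBySwaps.

Variables (T : Type) (w : T -> nat) (P : seq T -> Prop).

Hypothesis P_swap : forall pre a b post, w a < w b ->
  P (pre ++ a :: b :: post) -> P (pre ++ b :: a :: post).

Let ge_w : rel T := fun x y => w y <= w x.

(** The conclusion about [path] makes the induction work: once [x] has been moved
    past [y], the rest of the list must still be sorted below [y]. *)
Lemma insert_by_adjacent_swaps x s pre :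
  sorted ge_w s -> P (pre ++ x :: s) ->
  exists s', [/\ P (pre ++ s'), sorted ge_w s'
    & forall z, ge_w z x -> path ge_w z s -> path ge_w z s'].
Proof.
elim: s pre => [|y s IHs] pre.
  by move=> _ Ps; exists [:: x]; split=> // z /= ->.
move=> /= ys Ps; have [le_yx|lt_xy] := leqP (w y) (w x).
  exists (x :: y :: s); split=> //=; first by rewrite /ge_w le_yx.
  by move=> z -> /andP[_ ->]; rewrite /ge_w le_yx.
have:= P_swap lt_xy Ps; rewrite -cat_rcons => /IHs[].
  exact: path_sorted ys.
move=> s' [Ps' sorted_s' path_s']; exists (y :: s').
have ys' : path ge_w y s' by apply: path_s' => //; apply: ltnW.
by split=> //=; [rewrite -cat_rcons | move=> z _ /andP[-> _]].
Qed.

Lemma sort_by_adjacent_swaps s : P s -> exists2 s', P s' & sorted ge_w s'.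
Proof.
suff sort_suffix t pre : P (pre ++ t) ->
    exists2 t', P (pre ++ t') & sorted ge_w t' by exact: (sort_suffix s [::]).
elim: t pre => [|x t IHt] pre Pt; first by exists [::].
rewrite -cat_rcons in Pt; have [t' Pt' sorted_t'] := IHt _ Pt.
rewrite cat_rcons in Pt'.
by have [t'' [? ? _]] := insert_by_adjacent_swaps sorted_t' Pt'; exists t''.
Qed.

End SortBySwaps.

Section Rearrangement.

Context {R : idomainType} {C : chainComplex R}.

Implicit Types (e f g h : cell C) (T : {pred cell C}) (pre gs : seq (cell C)).

(** * Faces of a cell *)

Lemma deg_bd e f : f \in bd e -> (deg f).+1 = deg e.
Proof. by case: e => [[|n] b] //= /mapP[x _ ->]. Qed.

Lemma deg_face_level e k f : f \in face_level e k -> deg f + k = deg e.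
Proof.
elim: k f => [|k IHk] f /=; first by rewrite inE addn0 => /eqP->.
by case/flatten_mapP=> h /IHk <- /deg_bd <-; rewrite addnS.
Qed.

Lemma face_setP e f :
  reflect (exists k, f \in face_level e k) (f \in face_set e).
Proof.
apply: (iffP andP) => [[_ ?]|[k fe]]; first by exists (deg e - deg f).
by rewrite -(deg_face_level fe) leq_addr addKn.
Qed.

Lemma face_set_refl e : e \in face_set e.
Proof. by apply/face_setP; exists 0; rewrite inE. Qed.

Lemma deg_face e f : f \in face_set e -> deg f <= deg e.
Proof. by case/andP. Qed.

Lemma face_set_bd e f h : f \in face_set e -> h \in bd f -> h \in face_set e.
Proof.
case/face_setP=> k fe hf; apply/face_setP; exists k.+1.
by apply/flatten_mapP; exists f.
Qed.

Lemma face_set_trans e f h :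
  f \in face_set e -> h \in face_set f -> h \in face_set e.
Proof.
move=> fe /face_setP[k]; elim: k h => [|k IHk] h /=; first by rewrite inE => /eqP->.
by case/flatten_mapP=> f' /IHk; apply: face_set_bd.
Qed.

Lemma face_of_same_deg e f : f \in face_set e -> deg e <= deg f -> f = e.
Proof.
by case/andP=> _ + le_ef; move: le_ef; rewrite -subn_eq0 => /eqP-> /[!inE] /eqP.
Qed.

Lemma maximal_face e f : maximal_cell (Omega C) f -> f \in face_set e -> f = e.
Proof.
case=> _ max_f /face_setP[[|k]] /=; first by rewrite inE => /eqP.
by case/flatten_mapP=> h _ fh; have:= max_f h isT; rewrite fh.
Qed.

Lemma face_sets_closed gs f h :
  f \in face_sets gs -> h \in face_set f -> h \in face_sets gs.
Proof.
case/hasP=> g g_gs fg hf; apply/hasP; exists g => //.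
exact: face_set_trans hf.
Qed.

Lemma face_sets_rcons pre g e :
  (e \in face_sets (rcons pre g)) = (e \in face_set g) || (e \in face_sets pre).
Proof. by rewrite !inE has_rcons. Qed.

(** * Complexes of finite order and pure complexes *)

Lemma supp_basis_chain n (b : basis C n) :
  supp (basis_chain b) =i [:: Tagged (basis C) b].
Proof.
move=> e; rewrite inE; apply/mapP/eqP=> [[x]|->].
  by rewrite mem_enum inE ffunE; case: (x =P b) => [-> //|]; rewrite eqxx.
by exists b; rewrite // mem_enum inE ffunE eqxx oner_eq0.
Qed.

Lemma finite_order_deg_le T d e : finite_of_order T d -> e \in T -> deg e <= d.
Proof.
case: e => n b [_ no_chain _] bT; rewrite leqNgt; apply/negP=> lt_dn.
have b0 : basis_chain b = 0%R.
  by apply: no_chain => // f; rewrite supp_basis_chain inE => /eqP->.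
have:= supp_basis_chain b (Tagged (basis C) b).
rewrite b0 mem_head => /mapP[x].
by rewrite mem_enum inE ffunE eqxx.
Qed.

Lemma finite_order_top_cell T d : finite_of_order T d -> exists e, e \in T.
Proof.
case=> _ _ [x xT x_neq0].
case: (pickP [pred b | x b != 0%R]) => [b xb|x0].
  by exists (Tagged (basis C) b); apply: xT; apply: image_f.
by case: x_neq0; apply/ffunP=> b; rewrite ffunE; apply/eqP/negbFE/x0.
Qed.

(** Purity only climbs one degree at a time; iterating it reaches the top. *)
Lemma pure_face_of_top T d e : pure_of_order T d -> e \in T ->
  exists f, [/\ f \in T, deg f = d & e \in face_set f].
Proof.
case=> fin_T climb; move def_m: (d - deg e) => m.
elim: m e def_m => [|m IHm] e def_m eT.
  exists e; split; rewrite ?face_set_refl //; apply/eqP.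
  by rewrite eqn_leq (finite_order_deg_le fin_T eT) -subn_eq0 def_m.
have lt_ed : deg e < d by rewrite -subn_gt0 def_m.
have [|f] := climb _ e lt_ed; first by rewrite inE eT /=.
case/andP=> fT /eqP deg_f ef; have [|h [hT deg_h fh]] := IHm f _ fT.
  by rewrite deg_f subnS def_m.
by exists h; split=> //; apply: face_set_bd ef.
Qed.

Lemma eq_finite_of_order T T' d :
  T =i T' -> finite_of_order T d -> finite_of_order T' d.
Proof.
move=> eqT [subT no_chain [x xT x_neq0]]; split.
- by move=> e; rewrite -eqT => eT f fe; rewrite -eqT; apply: subT fe.
- by move=> n y lt_dn yT; apply: no_chain => // f /yT; rewrite eqT.
- by exists x => // f /xT; rewrite eqT.
Qed.

Lemma eq_pure_of_order T T' d :
  T =i T' -> pure_of_order T d -> pure_of_order T' d.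
Proof.
move=> eqT [fin_T climb]; split; first exact: eq_finite_of_order fin_T.
move=> n e lt_nd; rewrite inE -eqT => /(climb n e lt_nd)[f fT ef].
by exists f; rewrite // inE -eqT.
Qed.

(** * Attaching a cell to the preceding ones *)

(** This bundles what a shelling of positive order requires of one cell.  Below,
    [attached_along] runs through the list with the preceding cells as an
    accumulator, so that an exchange of neighbours affects only two conjuncts. *)
Definition attached pre g : Prop :=
  0 < deg g ->
  if pre is [::] then exists hs, shelling (lower_skeleton g) hs
  else pure_of_order (meet_previous pre g) (deg g).-1 /\
       exists2 hs, shelling (lower_skeleton g) hs &
         come_first (in_degree (meet_previous pre g) (deg g).-1) hs.

Fixpoint attached_along pre gs : Prop :=
  if gs is g :: gs' then attached pre g /\ attached_along (rcons pre g) gs'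
  else True.

Lemma attached_along_cat pre gs gs' :
  attached_along pre (gs ++ gs') <->
  attached_along pre gs /\ attached_along (pre ++ gs) gs'.
Proof.
elim: gs pre => [|g gs IHgs] pre /=; first by rewrite cats0; tauto.
by have:= IHgs (rcons pre g); rewrite cat_rcons; tauto.
Qed.

Lemma attached_alongP gs :
  attached_along [::] gs <->
  forall pre g post, gs = pre ++ g :: post -> attached pre g.
Proof.
split=> [att pre g post def_gs | att].
  by move: att; rewrite def_gs => /attached_along_cat[_ []].
suff att_suffix s pre : gs = pre ++ s -> attached_along pre s.
  exact: att_suffix.
elim: s pre => //= g s IHs pre def_gs.
by split; [apply: att def_gs | apply: IHs; rewrite cat_rcons].
Qed.

(** Attachment depends on the preceding cells only through the part of the cell
    that they cover, and on whether there are any. *)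
Lemma eq_attached pre pre' g : nilp pre = nilp pre' ->
  meet_previous pre g =i meet_previous pre' g -> attached pre g -> attached pre' g.
Proof.
move=> eq_nil eq_meet att g_gt0; move: {att}(att g_gt0).
case: pre pre' eq_nil eq_meet => [|x s] [|x' s'] //= _ eq_meet [pure_g].
case=> hs shell_hs [hs1 [hs2 [def_hs in1 in2]]].
split; first exact: eq_pure_of_order pure_g.
have eq_facets : in_degree (meet_previous (x :: s) g) (deg g).-1 =i
    in_degree (meet_previous (x' :: s') g) (deg g).-1.
  by move=> e; rewrite [LHS]inE [RHS]inE eq_meet.
exists hs => //; exists hs1, hs2.
by split=> // h; rewrite -eq_facets; [apply: in1 | apply: in2].
Qed.

Lemma eq_attached_along pre pre' gs : size pre = size pre' -> pre =i pre' ->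
  attached_along pre gs -> attached_along pre' gs.
Proof.
elim: gs pre pre' => //= g gs IHgs pre pre' eq_size eq_pre [att_g att_gs].
split; last first.
  apply: IHgs att_gs => [|e]; first by rewrite !size_rcons eq_size.
  by rewrite !mem_rcons !inE eq_pre.
apply: eq_attached att_g; first by rewrite /nilp eq_size.
by move=> e; rewrite !inE (eq_has_r eq_pre).
Qed.

(** * The exchange *)

(** The tops of the intersection have degree [deg b - 1 >= deg a], and the only
    face of [a] of such a degree is [a], which by maximality is not a face of
    [b]. *)
Lemma low_maximal_cell_adds_nothing pre a b :
    maximal_cell (Omega C) a -> deg a < deg b ->
    pure_of_order (meet_previous (rcons pre a) b) (deg b).-1 ->
  {subset meet_previous (rcons pre a) b <= face_sets pre}.
Proof.
move=> max_a lt_ab pure_b e /(pure_face_of_top pure_b)[f [fb deg_f ef]].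
apply: face_sets_closed ef; move: fb; rewrite inE face_sets_rcons.
case/andP=> fb /orP[fa|//].
have def_f : f = a.
  by apply: face_of_same_deg fa _; rewrite deg_f -ltnS (ltn_predK lt_ab).
rewrite def_f in fb; have:= maximal_face max_a fb.
by move=> eq_ab; rewrite eq_ab ltnn in lt_ab.
Qed.

Lemma attached_swap pre a b :
    maximal_cell (Omega C) a -> deg a < deg b ->
    attached pre a -> attached (rcons pre a) b ->
  attached pre b /\ attached (rcons pre b) a.
Proof.
move=> max_a lt_ab att_a att_b.
have pure_b : pure_of_order (meet_previous (rcons pre a) b) (deg b).-1.
  have:= att_b (leq_ltn_trans (leq0n _) lt_ab).
  by case E: (rcons pre a) => [|x s] => [|[]] //; case: (pre) E.
have covered := low_maximal_cell_adds_nothing max_a lt_ab pure_b.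
(* So exchanging never changes which cell comes first, the one that has no
   intersection to be pure. *)
have pre_nnil : ~~ nilp pre.
  have [e /covered] := finite_order_top_cell (proj1 pure_b).
  by case: (pre).
have eq_nil x : nilp (rcons pre x) = nilp pre.
  by rewrite (negPf pre_nnil); case: (pre).
split; [apply: eq_attached att_b; rewrite ?eq_nil // => e
       |apply: eq_attached att_a; rewrite ?eq_nil // => e].
  apply/andP/andP=> [[eb e_pre]|[eb e_pre]]; split=> //.
    by apply: covered; apply/andP.
  by rewrite face_sets_rcons e_pre orbT.
apply/andP/andP=> [[ea e_pre]|[ea]]; first by rewrite face_sets_rcons e_pre orbT.
rewrite face_sets_rcons => /orP[eb|//]; split=> //.
by apply: covered; apply/andP; rewrite face_sets_rcons ea.
Qed.

Lemma attached_along_swap pre a b post :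
    maximal_cell (Omega C) a -> deg a < deg b ->
  attached_along [::] (pre ++ a :: b :: post) ->
  attached_along [::] (pre ++ b :: a :: post).
Proof.
move=> max_a lt_ab /attached_along_cat[att_pre /= [att_a [att_b]]].
have [att_b' att_a'] := attached_swap max_a lt_ab att_a att_b.
move=> att_post; apply/attached_along_cat; do 3!split=> //; apply: eq_attached_along att_post.
  by rewrite !size_rcons.
by move=> e; rewrite !mem_rcons !inE !mem_rcons !inE orbCA.
Qed.

Lemma perm_is_order_of (P : cell C -> Prop) gs gs' :
  perm_eq gs gs' -> is_order_of P gs -> is_order_of P gs'.
Proof.
move=> eq_gs [uniq_gs gsP]; split; first by rewrite -(perm_uniq eq_gs).
by move=> e; rewrite -(perm_mem eq_gs); apply: gsP.
Qed.

End Rearrangement.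

Theorem theorem5p7 (R : idomainType) (hR : principal_ring R)
    (C : chainComplex R) (d : nat)
    (hd : finite_of_order (Omega C) d)
    (hsh : shellable (Omega C)) :
  exists gs : seq (cell C),
    shelling (Omega C) gs /\ monotonically_descending gs.
Proof.
case: hsh => gs shell_gs.
case: (shell_gs) => d' fin_d' ex_max order_gs S1 S2 S3.
have [d'0|d'_gt0] := posnP d'.
  (* In order 0 nothing constrains how the cells meet, but the degrees are all 0. *)
  exists gs; split=> //; rewrite /monotonically_descending.
  have deg0 (e : cell C) : deg e = 0.
    by apply/eqP; rewrite -leqn0 -d'0; apply: finite_order_deg_le fin_d' _.
  by apply: pairwise_sorted; elim: (gs) => //= g s ->;
     rewrite andbT; apply/allP=> m /mapP[e _ ->]; rewrite /= !deg0.
pose P s := is_order_of (maximal_cell (Omega C)) s /\ attached_along [::] s.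
have Pgs : P gs.
  split=> //; apply/attached_alongP=> -[|x pre] g post def_gs g_gt0.
    exact: S3 def_gs g_gt0.
  split; first exact: S1 def_gs _ g_gt0.
  exact: S2 def_gs _ g_gt0.
have P_swap pre a b post : deg a < deg b ->
    P (pre ++ a :: b :: post) -> P (pre ++ b :: a :: post).
  move=> lt_ab [order_s att_s]; split.
    apply: perm_is_order_of order_s.
    by rewrite perm_cat2l -(cat1s a) -(cat1s b) perm_catCA.
  apply: attached_along_swap att_s => //; apply/(proj2 order_s).
  by rewrite mem_cat mem_head orbT.
have [hs [order_hs /attached_alongP att_hs] desc_hs] :=
  sort_by_adjacent_swaps P_swap Pgs.
exists hs; split; last by rewrite /monotonically_descending sorted_map.
exists d' => // _.
- by case=> // x pre g post def_hs _ g_gt0; have [] := att_hs _ _ _ def_hs g_gt0.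
- by case=> // x pre g post def_hs _ g_gt0; have [] := att_hs _ _ _ def_hs g_gt0.
- by move=> g post def_hs g_gt0; exact: (att_hs [::] g post def_hs g_gt0).
Qed.
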